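(* Let $A$ be an integral domain and $E$ a finitely generated multiplication $A$-module. If $\operatorname{ann}(E)$ is a prime ideal, then the divisor topology $D(A/\operatorname{ann}(E))$ on the domain $A/\operatorname{ann}(E)$ and the quasi divisor topology $qD_A(E)$ are homeomorphic.
   Context: For an $A$-module $E$: $\operatorname{ann}(E)=\{a\in A: aE=0\}$, $W(E)=\{a\in A: aE\neq E\}$, $W(E)^{\#}=W(E)\setminus\operatorname{ann}(E)$. On $W(E)^{\#}$ put $a\sim b$ iff $aE=bE$; $[a]$ is the class of $a$ and $\operatorname{EC}(W(E)^{\#})$ is the set of all classes. For $a\in W(E)^{\#}$, $U_a=\{[b]\in\operatorname{EC}(W(E)^{\#}): aE\subseteq bE\}$. The quasi divisor topology $qD_A(E)$ is the topological space $\operatorname{EC}(W(E)^{\#})$ whose topology has basis $\{U_a\}_{a\in W(E)^{\#}}$. $E$ is a multiplication module if every submodule of $E$ has the form $IE$ for some ideal $I$ of $A$. The divisor topology $D(R)$ on an integral domain $R$: let $R^{\#}$ be the set of nonzero nonunits of $R$, with $a\sim b$ iff $aR=bR$; $D(R)$ is the set $\operatorname{EC}(R^{\#})$ of equivalence classes with the topology having as basis the sets $B_a=\{[b]\in\operatorname{EC}(R^{\#}): b\mid a\}$, $a\in R^{\#}$. *)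

(* Defs.v *)
From HB Require Import structures.
From mathcomp Require Import all_boot all_order all_algebra generic_quotient.
From mathcomp Require Import ring_quotient.
From mathcomp Require Import all_classical topology.

Set Implicit Arguments.
Unset Strict Implicit.
Unset Printing Implicit Defensive.

Import GRing.Theory.
Local Open Scope ring_scope.
Local Open Scope classical_set_scope.
Local Open Scope quotient_scope.

Section EquivalenceClasses.
Variables (A : choiceType) (V : Type) (X : set A) (F : A -> set V).

(* For [F a := aE] this is the relation a ~ b iff aE = bE on the set [X]. *)
Definition same (a b : X) : bool := `[< F (val a) = F (val b) >].

Lemma same_refl : reflexive same.
Proof. by move=> a; apply/asboolP. Qed.

Lemma same_sym : symmetric same.
Proof. by move=> a b; apply/asboolP/asboolP => ->. Qed.

Lemma same_trans : transitive same.
Proof. by move=> b a c /asboolP ab /asboolP bc; apply/asboolP; rewrite ab. Qed.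

Canonical same_equiv := EquivRel same same_refl same_sym same_trans.

Definition EC : Type := {eq_quot same}.

HB.instance Definition _ := EqQuotient.on EC.
HB.instance Definition _ := Choice.on EC.

Lemma eq_ECP (a b : X) : \pi_EC a = \pi_EC b <-> F (val a) = F (val b).
Proof.
split=> [/(@eqquotP _ same) /asboolP //|ab].
by apply/(@eqquotP _ same)/asboolP.
Qed.

End EquivalenceClasses.

Section DivisorTopology.
Variable R : idomainType.

Definition principal (a : R) : set R := range (fun r => a * r).

Definition divides (b a : R) : Prop := exists c, a = b * c.

Definition nonzero_nonunit : set R :=
  [set a | a != 0 /\ a \isn't a GRing.unit].

Definition divisor_space : Type := EC nonzero_nonunit principal.

HB.instance Definition _ := EqQuotient.on divisor_space.
HB.instance Definition _ := Choice.on divisor_space.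

Definition divisor_base (a : nonzero_nonunit) : set divisor_space :=
  [set \pi_divisor_space b | b in [set b | divides (val b) (val a)]].

Lemma divisor_baseE (a b : nonzero_nonunit) :
  divisor_base a (\pi_divisor_space b) <-> divides (val b) (val a).
Proof.
split=> [[c ca /eq_ECP cb]|]; last by exists b.
case: ca => d ->.
have [e _ <-] : principal (val b) (val c) by rewrite -cb; exists 1; rewrite ?mulr1.
by exists (e * d); rewrite mulrA.
Qed.

Lemma divisor_base_cover : \bigcup_(B in range divisor_base) B = setT.
Proof.
apply/seteqP; split=> // x _; rewrite -[x]reprK.
exists (divisor_base (repr x)); first by exists (repr x).
by apply/divisor_baseE; exists 1; rewrite mulr1.
Qed.

Lemma divisor_base_join (B C : set divisor_space) x :
  range divisor_base B -> range divisor_base C -> B x -> C x ->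
  exists D, [/\ range divisor_base D, D x & D `<=` B `&` C].
Proof.
move=> [a _ <-] [b _ <-]; rewrite -[x]reprK.
move=> /divisor_baseE[d ad] /divisor_baseE[e be].
exists (divisor_base (repr x)); split; first by exists (repr x).
  by apply/divisor_baseE; exists 1; rewrite mulr1.
move=> y; rewrite -[y]reprK => /divisor_baseE[f xf].
split; apply/divisor_baseE.
  by exists (f * d); rewrite ad xf mulrA.
by exists (f * e); rewrite be xf mulrA.
Qed.

HB.instance Definition _ := isBaseTopological.Build divisor_space
  divisor_base_cover divisor_base_join.

End DivisorTopology.

Section Modules.
Variables (A : idomainType) (E : lmodType A).

Definition scaled (a : A) : set E := range (fun x : E => a *: x).

Definition ann : set A := [set a | scaled a = [set 0]].

Definition W : set A := [set a | scaled a <> setT].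

Definition W_sharp : set A := W `\` ann.

Definition finitely_generated : Prop :=
  exists (n : nat) (g : 'I_n -> E),
    forall x, exists c : 'I_n -> A, x = \sum_(i < n) c i *: g i.

(* Improper ideals are allowed, unlike in [idealr_closed]. *)
Definition ideal (I : set A) : Prop := submod_closed ([in I] : {pred A^o}).

Definition submodule (N : set E) : Prop := submod_closed ([in N] : {pred E}).

Definition ideal_mul (I : set A) : set E :=
  [set x | exists (n : nat) (a : 'I_n -> A) (e : 'I_n -> E),
     (forall i, I (a i)) /\ x = \sum_(i < n) a i *: e i].

Definition multiplication_module : Prop :=
  forall N : set E, submodule N -> exists2 I, ideal I & N = ideal_mul I.

End Modules.

Arguments scaled {A} E a.

Section QuasiDivisorTopology.
Variables (A : idomainType) (E : lmodType A).

Definition quasi_divisor_space : Type := EC (W_sharp E) (scaled E).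

HB.instance Definition _ := EqQuotient.on quasi_divisor_space.
HB.instance Definition _ := Choice.on quasi_divisor_space.

Definition quasi_divisor_base (a : W_sharp E) : set quasi_divisor_space :=
  [set \pi_quasi_divisor_space b | b in
     [set b | scaled E (val a) `<=` scaled E (val b)]].

Lemma quasi_divisor_baseE (a b : W_sharp E) :
  quasi_divisor_base a (\pi_quasi_divisor_space b) <->
  scaled E (val a) `<=` scaled E (val b).
Proof.
split=> [[c /= ac /eq_ECP cb]|]; last by exists b.
by rewrite -cb.
Qed.

Lemma quasi_divisor_base_cover :
  \bigcup_(B in range quasi_divisor_base) B = setT.
Proof.
apply/seteqP; split=> // x _; rewrite -[x]reprK.
exists (quasi_divisor_base (repr x)); first by exists (repr x).
exact/quasi_divisor_baseE.
Qed.

Lemma quasi_divisor_base_join (B C : set quasi_divisor_space) x :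
  range quasi_divisor_base B -> range quasi_divisor_base C -> B x -> C x ->
  exists D, [/\ range quasi_divisor_base D, D x & D `<=` B `&` C].
Proof.
move=> [a _ <-] [b _ <-]; rewrite -[x]reprK.
move=> /quasi_divisor_baseE ax /quasi_divisor_baseE bx.
exists (quasi_divisor_base (repr x)); split; first by exists (repr x).
  exact/quasi_divisor_baseE.
move=> y; rewrite -[y]reprK => /quasi_divisor_baseE xy.
by split; apply/quasi_divisor_baseE; [move: ax|move: bx] => /subset_trans; apply.
Qed.

HB.instance Definition _ := isBaseTopological.Build quasi_divisor_space
  quasi_divisor_base_cover quasi_divisor_base_join.

End QuasiDivisorTopology.

Definition prime_ideal (A : idomainType) (I : set A) : Prop :=
  idealr_closed [in I] /\ prime_idealr_closed [in I].

Section QuotientDomain.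
Variables (A : idomainType) (I : set A) (pI : prime_ideal I).

(* The argument [pI] is unused in the body: it only serves to find the
   structure of prime ideal on [I]. *)
Definition prime_pred (_ : prime_ideal I) : A -> bool := fun a => a \in I.

HB.instance Definition _ := isIdealr.Build A (prime_pred pI) (proj1 pI).
HB.instance Definition _ :=
  isPrimeIdealrClosed.Build A (prime_pred pI) (proj2 pI).

Definition prime_ideal_of : prime_idealr A := prime_pred pI.

Definition quotient_domain : Type := {ideal_quot prime_ideal_of}.

HB.instance Definition _ := GRing.ComNzRing.on quotient_domain.
HB.instance Definition _ := NzRingQuotient.on quotient_domain.

(* The library gives the quotient no units; invertibility is decided
   classically. *)
Definition quotient_unit : {pred quotient_domain} :=
  fun x => `[< exists y, y * x = 1 >].

Definition quotient_inv (x : quotient_domain) : quotient_domain :=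
  xget x [set y | y * x = 1].

Lemma quotient_mulVr : {in quotient_unit, left_inverse 1 quotient_inv *%R}.
Proof.
move=> x /asboolP[y yx]; rewrite /quotient_inv.
by case: xgetP => [z _ //|/(_ y)].
Qed.

Lemma quotient_unitP (x y : quotient_domain) :
  y * x = 1 -> quotient_unit x.
Proof. by move=> yx; apply/asboolP; exists y. Qed.

Lemma quotient_invr_out :
  {in [predC quotient_unit], quotient_inv =1 id}.
Proof.
move=> x; rewrite inE /= => /asboolP nx; rewrite /quotient_inv.
by case: xgetP => // z _ zx; case: nx; exists z.
Qed.

HB.instance Definition _ := GRing.ComNzRing_hasMulInverse.Build quotient_domain
  quotient_mulVr quotient_unitP quotient_invr_out.

Lemma quotient_integral : GRing.integral_domain_axiom quotient_domain.
Proof.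
move=> x y; exact: (@Quotient.rquot_IdomainAxiom A prime_ideal_of x y).
Qed.

HB.instance Definition _ :=
  GRing.ComUnitRing_isIntegral.Build quotient_domain quotient_integral.

End QuotientDomain.

Definition homeomorphic (X Y : topologicalType) : Prop :=
  exists (f : X -> Y) (g : Y -> X),
    [/\ cancel f g, cancel g f, continuous f & continuous g].

(* Main.v *)
Require Import Defs.
From mathcomp Require Import all_boot all_order all_algebra.
From mathcomp Require Import all_classical topology.
From mathcomp Require Import generic_quotient ring_quotient.

(** Write [P] for the annihilator of [E] and [pi] for the projection of [A]
    onto [A / P].  Everything rests on one equivalence, valid for all [a] and
    [b] in [A]: [aE] is contained in [bE] if and only if [pi b] divides [pi a]
    ([scaled_subP]).

    One direction is formal: if [a = b c] modulo [P], then [a x = b (c x)].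
    For the other, [E] has no torsion over [A / P]: if [r x = 0] and
    [A x = I E], then [r I] kills [E], so the prime [P] contains [r] or it
    contains [I], and then [x = 0] ([ann_torsion_free]).  Suppose now that
    [aE] is contained in [bE].  Since [P] is proper, some [x] in [E] is
    nonzero; let [A x = I E].  Then [a x] lies in [I (a E)], hence in
    [I (b E) = b (I E) = b A x], say [a x = b c x], and torsion-freeness gives
    that [a - b c] is in [P].

    Used for [(a, b)] and for [(b, a)], the equivalence shows that [aE = bE]
    exactly when [pi a] and [pi b] are associate ([scaled_eqP]).  For [b = 1]
    this says that [aE = E] exactly when [pi a] is a unit, so that [W(E)^#] is
    the preimage of the nonzero nonunits of [A / P] ([W_sharpP]).  Hence [pi]
    induces a bijection between the two sets of classes, and this bijection
    preserves and reflects divisibility.  In both spaces every point has a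
    smallest neighbourhood, made of its divisors, so that a map which preserves
    divisibility is continuous. *)

Set Implicit Arguments.
Unset Strict Implicit.
Unset Printing Implicit Defensive.

Import GRing.Theory.
Local Open Scope ring_scope.
Local Open Scope classical_set_scope.
Local Open Scope quotient_scope.

(** The union of a family of basic sets contains the point [x] as soon as one
    of them, say [C], does, and then minimality of [B] puts [B] inside [C]. *)
Lemma nbhs_least_base (T : topologicalType) (base : set_system T)
    (opE : @open T = [set \bigcup_(C in D) C | D in [set D | D `<=` base]])
    (x : T) (B : set T) :
  base B -> B x -> (forall C, base C -> C x -> B `<=` C) ->
  forall U, nbhs x U <-> B `<=` U.
Proof.
move=> bB Bx minB U; split=> [|BU].
  rewrite nbhsE => -[V [Vop Vx] VU]; apply: subset_trans VU.
  move: Vop Vx; rewrite opE => -[D Dbase <-] [C DC Cx] y By.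
  by exists C => //; apply: minB By => //; exact: Dbase.
rewrite nbhsE; exists B => //; split=> //.
by rewrite opE; exists [set B]; [move=> _ ->|rewrite bigcup_set1].
Qed.

Lemma nbhs_divisor (R : idomainType) (a : @nonzero_nonunit R)
    (U : set (divisor_space R)) :
  nbhs (\pi_(divisor_space R) a) U <-> divisor_base a `<=` U.
Proof.
move: U; apply: (@nbhs_least_base _ (range (@divisor_base R))).
- by [].
- by exists a.
- by apply/divisor_baseE; exists 1; rewrite mulr1.
move=> _ [c _ <-] /divisor_baseE[d cE] y.
rewrite -[y]reprK => /divisor_baseE[e aE].
by apply/divisor_baseE; exists (e * d); rewrite cE aE mulrA.
Qed.

Lemma nbhs_quasi_divisor (A : idomainType) (E : lmodType A) (a : W_sharp E)
    (U : set (quasi_divisor_space E)) :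
  nbhs (\pi_(quasi_divisor_space E) a) U <-> quasi_divisor_base a `<=` U.
Proof.
move: U; apply: (@nbhs_least_base _ (range (@quasi_divisor_base A E))).
- by [].
- by exists a.
- exact/quasi_divisor_baseE.
move=> _ [c _ <-] /quasi_divisor_baseE ca y.
rewrite -[y]reprK => /quasi_divisor_baseE ay.
by apply/quasi_divisor_baseE; exact: subset_trans ay.
Qed.

Lemma principal_eqP (R : idomainType) (a b : R) :
  principal a = principal b <-> divides a b /\ divides b a.
Proof.
split=> [ab|[[c bE] [d aE]]].
  have [c _ bE] : principal a b by rewrite ab; exists 1; rewrite ?mulr1.
  have [d _ aE] : principal b a by rewrite -ab; exists 1; rewrite ?mulr1.
  by split; [exists c|exists d].
apply/seteqP; split=> _ [r _ <-].
  by exists (d * r); rewrite // mulrA -aE.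
by exists (c * r); rewrite // mulrA -bE.
Qed.

Lemma annP (A : idomainType) (E : lmodType A) (a : A) :
  ann E a <-> forall x : E, a *: x = 0.
Proof.
split=> [aE x|a0].
  have : scaled E a (a *: x) by exists x.
  by rewrite aE.
by apply/seteqP; split=> [_ [x _ <-]|_ ->]; [exact: a0|exists 0; rewrite ?scaler0].
Qed.

Section PrimeAnnihilator.
Variables (A : idomainType) (E : lmodType A).
Hypotheses (mulE : multiplication_module E) (pE : prime_ideal (ann E)).

(** This is the only use of the multiplication hypothesis: both torsion-freeness
    and the divisibility criterion need it for cyclic submodules alone. *)
Lemma cyclic_ideal_mul (x : E) :
  exists I : set A, forall y, ideal_mul I y <-> exists c, y = c *: x.
Proof.
have [|I _ IE] := mulE (N := [set c *: x | c in setT]).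
  split=> [|c u v]; first by apply/mem_set; exists 0; rewrite ?scale0r.
  move=> /set_mem[d _ <-] /set_mem[e _ <-]; apply/mem_set.
  by exists (c * d + e); rewrite // scalerDl scalerA.
exists I => y; rewrite -IE; split=> [[c _ <-]|[c ->]]; by exists c.
Qed.

(** Writing [A x = I E] turns the vanishing of [r] at the single vector [x] into
    the vanishing of [r I] on all of [E], where primality applies. *)
Lemma ann_torsion_free (r : A) (x : E) : r *: x = 0 -> ann E r \/ x = 0.
Proof.
move=> rx; have [I IE] := cyclic_ideal_mul x.
have [rP|rP] := pselect (ann E r); [by left|right].
have IP i : I i -> ann E i.
  move=> Ii; have /(proj2 pE) : r * i \in [in ann E].
    apply/mem_set/annP => y; rewrite -scalerA.
    have [|c ->] := (IE (i *: y)).1.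
      by exists 1%N, (fun=> i), (fun=> y); split; rewrite ?big_ord1.
    by rewrite scalerA mulrC -scalerA rx scaler0.
  by case/orP => /set_mem.
have [|n [a [e [Ia ->]]]] := (IE x).2; first by exists 1; rewrite scale1r.
by apply: big1 => i _; exact: (annP E _).1 (IP _ (Ia i)) _.
Qed.

Lemma exists_nonzero : exists x : E, x != 0.
Proof.
apply: contrapT => /forallNP E0; have [_ /negP P1 _] := proj1 pE.
by apply/P1/mem_set/annP => x; apply/eqP/negPn/negP; rewrite scale1r.
Qed.

Local Notation R := (quotient_domain pE).
Local Notation proj := (\pi_R : A -> R).

Lemma proj_eq (a b : A) : proj a = proj b <-> ann E (a - b).
Proof.
split=> [/eqP|ab]; last first.
  by apply/eqP; rewrite -(Quotient.idealrBE (prime_ideal_of pE)); apply/mem_set.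
by rewrite -(Quotient.idealrBE (prime_ideal_of pE)) => /set_mem.
Qed.

Lemma proj_eq0 (a : A) : proj a = 0 <-> ann E a.
Proof. by rewrite -[0 in X in X <-> _]pi_zeror proj_eq subr0. Qed.

(** Inclusion of [aE] in [bE] provides, for each vector [z], only some [w] with
    [a z = b w]; expanding a nonzero [x] along [A x = I E] brings the [w]'s
    back into [A x], and a single scalar [c] with [a x = b c x] is enough since
    [E] is torsion-free over [A / ann E]. *)
Lemma scaled_subP (a b : A) :
  scaled E a `<=` scaled E b <-> divides (proj b) (proj a).
Proof.
split=> [ab|[c]].
  have [x x0] := exists_nonzero; have [I IE] := cyclic_ideal_mul x.
  have [|n [i [e [Ii xE]]]] := (IE x).2; first by exists 1; rewrite scale1r.
  have /choice[y yE] k : exists y, a *: e k = b *: y.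
    by have [|y _ <-] := ab (a *: e k); [exists (e k)|exists y].
  (* [x = \sum_k i_k e_k] gives [a x = b \sum_k i_k y_k], a multiple of [b x]. *)
  have [|c cE] := (IE (\sum_(k < n) i k *: y k)).1; first by exists n, i, y.
  have abcx : (a - b * c) *: x = 0.
    rewrite scalerBl -scalerA -cE {1}xE !scaler_sumr -sumrB big1 // => k _.
    by rewrite scalerA [a * _]mulrC -scalerA yE !scalerA [b * _]mulrC subrr.
  exists (proj c); rewrite -pi_mulr; apply/proj_eq.
  by have [//|x00] := ann_torsion_free abcx; rewrite x00 eqxx in x0.
rewrite -[c]reprK -pi_mulr => /proj_eq/annP abc _ [x _ <-].
exists (repr c *: x) => //; apply/esym/eqP.
by rewrite scalerA -subr_eq0 -scalerBl abc.
Qed.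

Lemma scaled_eqP (a b : A) :
  scaled E a = scaled E b <-> principal (proj a) = principal (proj b).
Proof.
rewrite principal_eqP -!scaled_subP.
by split=> [->|[ba ab]]; [split|apply/seteqP; split].
Qed.

(** A unit of the quotient is a divisor of [1], and [1 E = E]. *)
Lemma W_sharpP (a : A) : W_sharp E a <-> nonzero_nonunit (proj a).
Proof.
have WP : scaled E a = setT <-> proj a \is a GRing.unit.
  have -> : setT = scaled E 1.
    by apply/seteqP; split=> // x _; exists x; rewrite ?scale1r.
  rewrite scaled_eqP principal_eqP pi_oner; split=> [[[c c1] _]|u].
    by apply/unitrP; exists c; rewrite mulrC.
  by split; [exists (proj a)^-1; rewrite divrr|exists (proj a); rewrite mul1r].
split=> [[aW aP]|[/eqP a0 /negP aU]].
  by split; [apply/eqP => /proj_eq0|apply/negP => /WP].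
by split=> [/WP|/proj_eq0].
Qed.

Definition project_class (a : W_sharp E) : @nonzero_nonunit R :=
  exist _ (proj (val a)) (mem_set ((W_sharpP _).1 (set_mem (valP a)))).

Lemma lift_subproof (r : @nonzero_nonunit R) : repr (val r) \in W_sharp E.
Proof. by apply/mem_set/W_sharpP; rewrite reprK; exact: set_mem (valP r). Qed.

Definition lift_class (r : @nonzero_nonunit R) : W_sharp E :=
  exist _ (repr (val r)) (lift_subproof r).

End PrimeAnnihilator.

Theorem theorem5 (A : idomainType) (E : lmodType A)
    (fgE : finitely_generated E) (mulE : multiplication_module E)
    (pE : prime_ideal (ann E)) :
  homeomorphic (divisor_space (quotient_domain pE)) (quasi_divisor_space E).
Proof.
set X := divisor_space _; set Y := quasi_divisor_space E.
pose f (x : X) : Y := \pi_Y (lift_class mulE (repr x)).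
pose g (y : Y) : X := \pi_X (project_class mulE pE (repr y)).
(* Both maps go through representatives; [fE] and [gE] say that the choice of
   representative does not matter. *)
have fE r : f (\pi_X r) = \pi_Y (lift_class mulE r).
  apply/eq_ECP/(scaled_eqP mulE pE); rewrite /= !reprK.
  by apply/eq_ECP; rewrite reprK.
have gE a : g (\pi_Y a) = \pi_X (project_class mulE pE a).
  by apply/eq_ECP/scaled_eqP => //=; apply/eq_ECP; rewrite reprK.
exists f, g; split.
- by move=> x; rewrite -[x]reprK fE gE; apply/eq_ECP; rewrite /= reprK.
- move=> y; rewrite -[y]reprK gE fE; apply/eq_ECP/(scaled_eqP mulE pE).
  by rewrite /= reprK.
- move=> x; rewrite -[x]reprK => U; rewrite fE => /nbhs_quasi_divisor aU.
  apply/nbhs_divisor => y; rewrite -[y]reprK => /divisor_baseE dv.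
  rewrite /preimage/= fE; apply/aU/quasi_divisor_baseE/(scaled_subP mulE pE).
  by rewrite /= !reprK.
- move=> y; rewrite -[y]reprK => U; rewrite gE => /nbhs_divisor aU.
  apply/nbhs_quasi_divisor => x; rewrite -[x]reprK => /quasi_divisor_baseE sub.
  rewrite /preimage/= gE; apply/aU/divisor_baseE.
  exact/(scaled_subP mulE pE).
Qed.
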